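(* Let $G_0=(G,* )$ be a noncommutative groupoid. Then $G_0$ has an anti-automorphism if and only if $G_0^T\in\mathcal{M}_I(G_0)$. In this case, $|Ant(G_0)|=|Aut(G_0)|$.
   Context: A groupoid is a nonempty set with a binary operation. For groupoids $(A,* )$ and $(B,\cdot)$, a bijection $f:A\to B$ is a half-isomorphism if $f(x*y)\in\{f(x)\cdot f(y),f(y)\cdot f(x)\}$ for all $x,y\in A$; it is special if $f^{-1}$ is also a half-isomorphism. An anti-automorphism of $(G,* )$ is a bijection $f:G\to G$ with $f(x*y)=f(y)*f(x)$ for all $x,y\in G$. $Ant(G_0)$ is the set of anti-automorphisms and $Aut(G_0)$ the set of automorphisms of $G_0$. $G_0^T=(G,\cdot)$ is the groupoid with $x\cdot y=y*x$ for all $x,y\in G$. A principal h-groupoid of $G_0$ is a groupoid $(G,\cdot)$ on the same underlying set $G$ for which the identity mapping $G_0\to(G,\cdot)$ is a special half-isomorphism. $\mathcal{M}_I(G_0)$ is the set of principal h-groupoids of $G_0$ that are isomorphic to $G_0$. *)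

(* Defs.v *)
From mathcomp Require Import all_boot.
From mathcomp Require Import boolp classical_sets functions cardinality.

Set Implicit Arguments.
Unset Strict Implicit.
Unset Printing Implicit Defensive.

Local Open Scope classical_set_scope.

(* A groupoid (A, opA) is given by its carrier and its operation; several
   operations on one carrier are compared below, hence no canonical structure.
   Nonemptiness of the carrier is a hypothesis where groupoids are quantified. *)

Definition half_isomorphism (A B : Type) (opA : A -> A -> A)
    (opB : B -> B -> B) (f : A -> B) : Prop :=
  bijective f /\
  forall x y, f (opA x y) = opB (f x) (f y) \/ f (opA x y) = opB (f y) (f x).

Definition special_half_isomorphism (A B : Type) (opA : A -> A -> A)
    (opB : B -> B -> B) (f : A -> B) : Prop :=
  half_isomorphism opA opB f /\
  exists g : B -> A,
    [/\ cancel f g, cancel g f & half_isomorphism opB opA g].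

Definition isomorphism (A B : Type) (opA : A -> A -> A)
    (opB : B -> B -> B) (f : A -> B) : Prop :=
  bijective f /\ {morph f : x y / opA x y >-> opB x y}.

Definition isomorphic (A B : Type) (opA : A -> A -> A)
    (opB : B -> B -> B) : Prop :=
  exists f : A -> B, isomorphism opA opB f.

Definition Aut (G : Type) (op : G -> G -> G) : set (G -> G) :=
  [set f | isomorphism op op f].

Definition Ant (G : Type) (op : G -> G -> G) : set (G -> G) :=
  [set f | bijective f /\ forall x y, f (op x y) = op (f y) (f x)].

Definition transpose (G : Type) (op : G -> G -> G) : G -> G -> G :=
  fun x y => op y x.

Definition principal_h_groupoid (G : Type) (op op' : G -> G -> G) : Prop :=
  special_half_isomorphism op op' (fun x : G => x).

Definition M_I (G : Type) (op : G -> G -> G) : set (G -> G -> G) :=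
  [set op' | principal_h_groupoid op op' /\ isomorphic op' op].

(* Main.v *)
Require Import Defs.
From mathcomp Require Import all_boot.
From mathcomp Require Import boolp classical_sets functions cardinality.

Local Open Scope classical_set_scope.

(** An anti-automorphism of [op] is the same map as an isomorphism from [transpose op] to [op];
    since the transpose is always a principal h-groupoid, the equivalence follows. For the
    cardinalities, the product of two anti-automorphisms is an automorphism and a mixed product is
    an anti-automorphism, so one fixed anti-automorphism [a] makes [Ant op] the coset of [Aut op] by
    [a] ([Ant_card_Aut]). *)

Lemma Ant_isomorphism (G : Type) (op : G -> G -> G) (f : G -> G) :
  Ant op f <-> isomorphism (transpose op) op f.
Proof. by split=> -[bf fM]; split=> // x y; exact: fM. Qed.

(** The identity reverses every product, in both directions, so the second alternative of a
    half-isomorphism always holds. *)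
Lemma principal_transpose (G : Type) (op : G -> G -> G) :
  principal_h_groupoid op (transpose op).
Proof.
have bid : bijective (fun x : G => x) by exists id.
split; first by split=> // x y; right.
by exists id; split=> //; split=> // x y; right.
Qed.

Lemma Ant_inverse (G : Type) (op : G -> G -> G) (a b : G -> G) :
  cancel a b -> cancel b a -> Ant op a -> Ant op b.
Proof.
move=> ab ba [_ aM]; split; first by exists a.
by move=> x y; apply: (can_inj ab); rewrite aM !ba.
Qed.

Lemma Aut_comp_Ant (G : Type) (op : G -> G -> G) (a f : G -> G) :
  Ant op a -> Aut op f -> Ant op (f \o a).
Proof.
move=> [ba aM] [bf fM]; split; first exact: bij_comp.
by move=> x y /=; rewrite aM fM.
Qed.

Lemma Ant_comp_Ant (G : Type) (op : G -> G -> G) (a f : G -> G) :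
  Ant op a -> Ant op f -> Aut op (f \o a).
Proof.
move=> [ba aM] [bf fM]; split; first exact: bij_comp.
by move=> x y /=; rewrite aM fM.
Qed.

Lemma Ant_card_Aut (G : Type) (op : G -> G -> G) (a : G -> G) :
  Ant op a -> (Ant op #= Aut op)%card.
Proof.
move=> Aa; have [[b ab ba] _] := Aa.
(* Right translation by [a] carries Aut onto Ant. *)
have -> : Ant op = (fun f => f \o a) @` Aut op.
  apply/seteqP; split=> [f Af|_ [f Af <-]]; last exact: Aut_comp_Ant.
  (* The preimage of [f] is its product with the inverse [b] of [a], an automorphism because both
     factors reverse products. *)
  exists (f \o b); last by apply: funext => x /=; rewrite ab.
  by apply: Ant_comp_Ant Af; apply: Ant_inverse Aa.
(* Translation is injective since [a] is onto: each [x] is [a (b x)]. *)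
apply: inj_card_eq => f g _ _ fg; apply: funext => x.
by rewrite -(ba x); exact: (congr1 (@^~ (b x)) fg).
Qed.

Theorem proposition4p5 (G : Type) (G_nonempty : inhabited G)
    (op : G -> G -> G) (op_noncomm : ~ commutative op) :
  ((exists f : G -> G, Ant op f) <-> M_I op (transpose op)) /\
  ((exists f : G -> G, Ant op f) -> (Ant op #= Aut op)%card).
Proof.
split; last by move=> [a /Ant_card_Aut].
split=> [[f Af]|[_ [f If]]].
  by split; [exact: principal_transpose | exists f; exact/Ant_isomorphism].
by exists f; exact/Ant_isomorphism.
Qed.
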